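(* Let $d\ge2$, $X=\{0,\dots,d-1\}$, and let $G\le\mathrm{Aut}(X^* )$ be a recurrent group whose action on $X$ is doubly transitive. Then for all $n\ge0$, all $w\in X^n$ and all $i,j\in X$ with $i\ne j$, there exists $g\in G$ acting trivially on $X^n$ such that $g|_w(i)=j$. *)

(* Defs.v *)
From mathcomp Require Import all_boot.

Set Implicit Arguments.
Unset Strict Implicit.
Unset Printing Implicit Defensive.

(* The alphabet X is 'I_d, the vertex set X^* of the rooted d-ary tree is     *)
(* seq 'I_d (root [::]), and the level X^n is n.-tuple 'I_d.                  *)

Definition tree_edge (d : nat) (u v : seq 'I_d) : Prop :=
  exists x : 'I_d, v = rcons u x \/ u = rcons v x.

(* Membership in Aut(X^* ): automorphisms of the rooted tree. *)
Definition tree_aut (d : nat) (g : seq 'I_d -> seq 'I_d) : Prop :=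
  [/\ bijective g, g [::] = [::]
    & forall u v, tree_edge u v <-> tree_edge (g u) (g v)].

(* The section g|_v, characterised for a tree automorphism g by               *)
(* g (v ++ u) = g v ++ section g v u; see cat_section below.                  *)
Definition section (d : nat) (g : seq 'I_d -> seq 'I_d) (v : seq 'I_d) :
    seq 'I_d -> seq 'I_d :=
  fun u => drop (size v) (g (v ++ u)).

Definition aut_subgroup (d : nat) (G : (seq 'I_d -> seq 'I_d) -> Prop) : Prop :=
  [/\ forall g, G g -> tree_aut g,
      G id,
      forall g h, G g -> G h -> G (g \o h)
    & forall g h, G g -> cancel g h -> cancel h g -> G h].

Definition self_similar (d : nat) (G : (seq 'I_d -> seq 'I_d) -> Prop) : Prop :=
  forall g v, G g -> G (section g v).

Definition transitive_on_letters (d : nat)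
    (G : (seq 'I_d -> seq 'I_d) -> Prop) : Prop :=
  forall x y : 'I_d, exists2 g, G g & g [:: x] = [:: y].

Definition doubly_transitive_on_letters (d : nat)
    (G : (seq 'I_d -> seq 'I_d) -> Prop) : Prop :=
  forall x1 x2 y1 y2 : 'I_d, x1 <> x2 -> y1 <> y2 ->
    exists2 g, G g & g [:: x1] = [:: y1] /\ g [:: x2] = [:: y2].

(* Recurrent (= self-replicating): self-similar, transitive on X, and, for    *)
(* each letter x, g |-> g|_x maps the stabiliser of x in G onto G. Given the  *)
(* first two conditions, "each x" and "some x" are equivalent by conjugation. *)
Definition recurrent (d : nat) (G : (seq 'I_d -> seq 'I_d) -> Prop) : Prop :=
  [/\ self_similar G,
      transitive_on_letters G
    & forall (x : 'I_d) h, G h ->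
        exists g, [/\ G g, g [:: x] = [:: x] & section g [:: x] = h]].

Lemma tree_aut_rcons (d : nat) (g : seq 'I_d -> seq 'I_d) :
  tree_aut g -> forall v x, exists y, g (rcons v x) = rcons (g v) y.
Proof.
case=> /bij_inj injg g0 edg; elim/last_ind => [|v z IHv] x.
  have [|y []] := (edg [::] [:: x]).1; first by exists x; left.
    by move=> ->; exists y; rewrite g0.
  by rewrite g0; case: (g [:: x]).
have [|y [->|e]] := (edg (rcons v z) (rcons (rcons v z) x)).1.
- by exists x; left.
- by exists y.
have [t et] := IHv z; move: e; rewrite et => /rcons_inj [/injg e _].
by have := congr1 size e; rewrite !size_rcons => /eqP; rewrite -addn2 -{1}[size v]addn0 eqn_add2l.
Qed.

Lemma size_tree_aut (d : nat) (g : seq 'I_d -> seq 'I_d) :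
  tree_aut g -> forall v, size (g v) = size v.
Proof.
move=> ag; elim/last_ind => [|v x IHv]; first by case: ag => _ ->.
by have [y ->] := tree_aut_rcons ag v x; rewrite !size_rcons IHv.
Qed.

Lemma cat_section (d : nat) (g : seq 'I_d -> seq 'I_d) :
  tree_aut g -> forall v u, g (v ++ u) = g v ++ section g v u.
Proof.
move=> ag v u; rewrite /section.
suff [s ->] : exists s, g (v ++ u) = g v ++ s.
  by rewrite drop_size_cat // size_tree_aut.
elim/last_ind: u => [|u x [s es]]; first by exists [::]; rewrite !cats0.
have [y] := tree_aut_rcons ag (v ++ u) x.
by rewrite -rcons_cat => ->; exists (rcons s y); rewrite es rcons_cat.
Qed.

(* Main.v *)
Require Import Defs.
From mathcomp Require Import all_boot.
From Stdlib Require Import Classical.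

(** Recurrence and transitivity on letters provide, for any words v, w of the
same length and any h in G, an element k of G with k(v) = w and k|_v = h.
If every element of G fixing level n fixed level n + 1, then by self-similarity
it would fix all deeper levels, so G would act on level n faithfully and be
finite, contradicting transitivity on all levels. Hence some g in G fixes level
n and satisfies g(va) = vb with a <> b. By double transitivity choose h in G
with h(a) = i, h(b) = j, and lift it to k as above: k g k^-1 is the required
element. *)

Set Implicit Arguments.
Unset Strict Implicit.
Unset Printing Implicit Defensive.

Definition fixes_level (d n : nat) (g : seq 'I_d -> seq 'I_d) : Prop :=
  forall u, size u = n -> g u = u.

Lemma aut_subgroup_inv (d : nat) (G : (seq 'I_d -> seq 'I_d) -> Prop) g :
  aut_subgroup G -> G g -> exists g', [/\ G g', cancel g g' & cancel g' g].
Proof.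
case=> autG _ _ invG Gg; have [[g' gK g'K] _ _] := autG g Gg.
by exists g'; split=> //; apply: invG gK g'K.
Qed.

(** Take [s] in [G] sending [x] to [y] and, by recurrence, [r] fixing [x] whose section there is the
    inverse of that of [s] followed after [k]; then [s \o r] acts below [x] as [k]. *)
Lemma recurrent_lift (d : nat) (G : (seq 'I_d -> seq 'I_d) -> Prop) :
  aut_subgroup G -> recurrent G ->
  forall v w h, size v = size w -> G h ->
  exists2 k, G k & forall u, k (v ++ u) = w ++ h u.
Proof.
move=> sgG [ssG trG liftG]; have [autG _ mulG _] := sgG.
elim=> [|x v IHv] [|y w] // h; first by exists h.
move=> [/IHv IH] /IH [k Gk kE]; have [s Gs sx] := trG x y.
have [s' [Gs' _ s'K]] := aut_subgroup_inv sgG (ssG s [:: x] Gs).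
have [r [Gr rx rE]] := liftG x (s' \o k) (mulG _ _ Gs' Gk).
exists (s \o r) => [|u /=]; first exact: mulG.
rewrite -cat1s (cat_section (autG r Gr)) rx rE (cat_section (autG s Gs)) sx /=.
by rewrite s'K kE.
Qed.

(** The section of [g] at a letter fixes level [n], hence level [n.+1] by hypothesis. *)
Lemma fixes_levelS_step (d : nat) (G : (seq 'I_d -> seq 'I_d) -> Prop) n :
  aut_subgroup G -> self_similar G ->
  (forall g, G g -> fixes_level n g -> fixes_level n.+1 g) ->
  forall g, G g -> fixes_level n.+1 g -> fixes_level n.+2 g.
Proof.
move=> [autG _ _ _] ssG fixS g Gg gn [|x u] // [su].
have fix_sec : fixes_level n.+1 (section g [:: x]).
  apply: fixS => [|t st]; first exact: ssG.
  by rewrite /section /= gn /= ?st // drop0.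
have gx : g [:: x] = [:: x].
  (* This word has length [n.+1], so [g] fixes it and in particular its first letter. *)
  have := gn (x :: take n u); rewrite /= size_takel ?su // => /(_ erefl).
  rewrite -cat1s (cat_section (autG g Gg)).
  have := size_tree_aut (autG g Gg) [:: x].
  by case: (g [:: x]) => [|z []] //= _ [->].
by rewrite -cat1s (cat_section (autG g Gg)) gx fix_sec.
Qed.

Lemma fixes_level_stable (d : nat) (G : (seq 'I_d -> seq 'I_d) -> Prop) n :
  aut_subgroup G -> self_similar G ->
  (forall g, G g -> fixes_level n g -> fixes_level n.+1 g) ->
  forall m g, G g -> fixes_level n g -> fixes_level (n + m) g.
Proof.
move=> sgG ssG fixS; elim=> [|m IHm] g Gg gn; first by rewrite addn0.
have fixSm : forall g, G g -> fixes_level (n + m) g ->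
    fixes_level (n + m).+1 g.
  elim: m {IHm} => [|m IHm]; first by rewrite addn0.
  by rewrite addnS; apply: fixes_levelS_step.
by rewrite addnS; apply: fixSm => //; apply: IHm.
Qed.

(* Pigeonhole: elements sending a fixed vertex of level n + N to each vertex of
   that level are distinguished by their action on level n, but there are only
   N self-maps of level n. *)
Lemma not_fixes_level_stable (d : nat) (G : (seq 'I_d -> seq 'I_d) -> Prop) n :
  1 < d -> aut_subgroup G -> recurrent G ->
  ~ (forall g, G g -> fixes_level n g -> fixes_level n.+1 g).
Proof.
move=> d_gt1 sgG recG fixS; have [autG idG mulG _] := sgG.
have [ssG _ _] := recG.
pose N := #|{ffun n.-tuple 'I_d -> n.-tuple 'I_d}|; pose m := n + N.
pose v0 := nseq m (Ordinal (ltnW d_gt1)).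
have /fin_all_exists [f fP] : forall v : m.-tuple 'I_d,
    exists k, G k /\ k v0 = v.
  move=> v; have sv : size v0 = size v by rewrite size_nseq size_tuple.
  have [k Gk kE] := recurrent_lift sgG recG sv idG.
  by exists k; split=> //; rewrite -[v0]cats0 kE cats0.
(* The default [u] is never reached, as [f v] preserves length. *)
pose F v : {ffun n.-tuple 'I_d -> n.-tuple 'I_d} :=
    [ffun u => insubd u (f v (val u))].
have injF : injective F.
  move=> v1 v2 eqF; have [[G1 f1] [G2 f2]] := (fP v1, fP v2).
  have [k [Gk kK Kk]] := aut_subgroup_inv sgG G1.
  have fixk : fixes_level n (k \o f v2).
    move=> u /eqP su; pose t := Tuple su; rewrite /= -{2}[u]kK.
    have /(congr1 val) := congr1 (fun F1 : {ffun _ -> _} => F1 t) eqF.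
    by rewrite !ffunE !val_insubd /= !size_tree_aut ?su; auto => ->.
  have := fixes_level_stable sgG ssG fixS (m := N) (mulG _ _ Gk G2) fixk.
  move=> /(_ v0); rewrite size_nseq => /(_ erefl) /= /(congr1 (f v1)).
  by rewrite Kk f1 f2 => /val_inj ->.
(* Injectivity would give [d ^ m <= N], but [N <= m < d ^ m]. *)
have := leq_card F injF; rewrite card_tuple card_ord leqNgt => /negP; apply.
by apply: leq_trans (ltn_expl m d_gt1); rewrite ltnS leq_addl.
Qed.

Lemma exists_level_stabilizer_moving (d : nat)
    (G : (seq 'I_d -> seq 'I_d) -> Prop) n :
  1 < d -> aut_subgroup G -> recurrent G ->
  exists g v a b, [/\ G g, fixes_level n g, size v = n, a <> b
                    & g (rcons v a) = rcons v b].
Proof.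
move=> d_gt1 sgG recG; apply: NNPP => noG.
have [autG _ _ _] := sgG.
apply: (not_fixes_level_stable (n := n) d_gt1 sgG recG) => g Gg gn u.
case/lastP: u => // v a; rewrite size_rcons => -[sv].
have [b gb] := tree_aut_rcons (autG g Gg) v a; rewrite (gn v) // in gb.
have [eab|/eqP nab] := eqVneq a b; first by rewrite gb eab.
by case: noG; exists g, v, a, b; split.
Qed.

Theorem theorem5p14 (d : nat) (hd : 2 <= d)
    (G : (seq 'I_d -> seq 'I_d) -> Prop)
    (hG : aut_subgroup G) (hrec : recurrent G)
    (h2 : doubly_transitive_on_letters G)
    (n : nat) (w : n.-tuple 'I_d) (i j : 'I_d) (hij : i <> j) :
  exists g, [/\ G g,
                forall u : n.-tuple 'I_d, g u = u
              & section g w [:: i] = [:: j]].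
Proof.
have [g [v [a [b [Gg gn sv nab gab]]]]] :=
  exists_level_stabilizer_moving n hd hG hrec.
have [autG _ mulG _] := hG.
have [h Gh [ha hb]] := h2 _ _ _ _ nab hij.
have svw : size v = size w by rewrite sv size_tuple.
have [k Gk kE] := recurrent_lift hG hrec svw Gh.
have [k' [Gk' kK k'K]] := aut_subgroup_inv hG Gk.
exists (k \o (g \o k')); split=> [|u|].
- exact: (mulG _ _ Gk (mulG _ _ Gg Gk')).
- by rewrite /= gn ?k'K // size_tree_aut ?size_tuple //; apply: autG.
(* The conjugate sends [w i] to [v a] by [k'], to [v b] by [g], then to [w j] by [k]. *)
by rewrite /section /= -ha -kE kK cats1 gab -cats1 kE hb drop_size_cat.
Qed.
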